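(* Consider the inhomogeneous renewal risk model with claim sizes $\{Z_1,Z_2,\ldots\}$, inter-occurrence times $\{\theta_1,\theta_2,\ldots\}$ and premium rate $p>0$, and put $\xi_k=Z_k-p\,\theta_k$, $k\in\mathbb{N}$. Suppose that, for some constants $a>0$, $b\in\mathbb{N}$, $c>0$, $\varepsilon\geqslant 0$, $h>0$, $d_1\geqslant 1$ and $d_2\geqslant 1$: (i) $\displaystyle \frac1n\sum_{i=1}^n \mathbb{E}\,\xi_i\leqslant -a$ for all $n\geqslant b$; (ii) $\displaystyle \sup_{n\geqslant b}\frac1n\sum_{i=1}^n \mathbb{E}\big(|\xi_i|\mathbf{1}_{\{\xi_i\leqslant -c\}}\big)\leqslant \varepsilon$; (iii) $\displaystyle \sup_{n\geqslant b}\frac1n\sum_{i=1}^n \Big(\mathbb{P}(\xi_i\leqslant 0)+\mathbb{E}\big(e^{h\xi_i}\mathbf{1}_{\{\xi_i>0\}}\big)\Big)\leqslant d_1$; (iv) $\displaystyle \max_{1\leqslant n\leqslant b-1}\frac1n\sum_{i=1}^n \Big(\mathbb{P}(\xi_i\leqslant 0)+\mathbb{E}\big(e^{h\xi_i}\mathbf{1}_{\{\xi_i>0\}}\big)\Big)\leqslant d_2$; and that $\delta\in(0,1/2]$ satisfies $$-\Delta:=\varepsilon+\delta h d_1\max\Big\{\frac{c^2}{2},\frac{2}{h^2}\Big\}-a<0.$$ Then the ruin probability of the model satisfies $$\psi(u)\leqslant \min\big\{1,\,c_1e^{-\delta h u}\big\},\qquad u\geqslant 0,$$ where $$c_1=S(b,d_2)+\frac{\exp\{-\delta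 h\Delta b\}}{1-\exp\{-\delta h\Delta\}},\qquad S(b,d_2)=\begin{cases} d_2\,\dfrac{d_2^{\,b-1}-1}{d_2-1} & \text{if } d_2>1,\\[2mm] b-1 & \text{if } d_2=1.\end{cases}$$
   Context: Inhomogeneous renewal risk model: the insurer's surplus process is $$R(t)=u+pt-\sum_{i=1}^{\Theta(t)}Z_i,\qquad t\geqslant 0,$$ where $u\geqslant 0$ is the initial surplus; $p>0$ is a constant premium rate; the claim sizes $\{Z_1,Z_2,\ldots\}$ are independent nonnegative, not necessarily identically distributed random variables; $\Theta(t)=\sum_{n=1}^\infty \mathbf{1}_{\{\theta_1+\cdots+\theta_n\leqslant t\}}$ is the renewal counting process generated by the inter-occurrence times $\{\theta_1,\theta_2,\ldots\}$, which are independent nonnegative random variables, nondegenerate at zero and possibly not identically distributed; and the sequences $\{Z_1,Z_2,\ldots\}$ and $\{\theta_1,\theta_2,\ldots\}$ are independent of each other. The (ultimate) ruin probability is $$\psi(u)=\mathbb{P}\Big(\inf_{t\geqslant 0}R(t)<0\Big)=\mathbb{P}\Big(\sup_{n\geqslant 1}\sum_{k=1}^n(Z_k-p\,\theta_k)>u\Big).$$ $\mathbf{1}_A$ denotes the indicator of the event $A$, $\mathbb{N}=\{1,2,\ldots\}$, and empty sums are zero. When $b=1$, condition (iv) ranges over no $n$ and is vacuous. *)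

(* Defs.v *)
(* Sequences indexed by {1, 2, ...} in the mathematics are
   functions on [nat] here: the k-th term (k >= 1) is the value at k - 1. *)
From HB Require Import structures.
From mathcomp Require Import all_boot all_order all_algebra.
From mathcomp Require Import all_classical all_reals all_analysis.

Set Implicit Arguments.
Unset Strict Implicit.
Unset Printing Implicit Defensive.

Import Order.TTheory GRing.Theory Num.Theory.
Import numFieldNormedType.Exports.

Local Open Scope classical_set_scope.
Local Open Scope ring_scope.

Section independence.
Context {d : measure_display} {T : measurableType d} {R : realType}.
Variable P : probability T R.

Definition independent_RVs (X : nat -> {RV P >-> R}) : Prop :=
  forall (J : seq nat) (A : nat -> set R), uniq J ->
    (forall i, i \in J -> measurable (A i)) ->
    P (\bigcap_(i in [set` J]) (X i @^-1` A i)) =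
    (\prod_(i <- J) P (X i @^-1` A i))%E.

Definition sigma_RVs (X : nat -> {RV P >-> R}) : set (set T) :=
  <<s \bigcup_i preimage_set_system setT (X i) measurable >>.

Definition independent_sequences (X Y : nat -> {RV P >-> R}) : Prop :=
  forall A B, sigma_RVs X A -> sigma_RVs Y B ->
    P (A `&` B) = (P A * P B)%E.

End independence.

Section risk_model.
Context {d : measure_display} {T : measurableType d} {R : realType}.
Variable P : probability T R.

Record inhomogeneous_renewal_risk_model
    (p : R) (Z theta : nat -> {RV P >-> R}) : Prop := {
  premium_gt0 : 0 < p;
  claims_ge0 : forall i w, 0 <= Z i w;
  claims_independent : independent_RVs Z;
  times_ge0 : forall i w, 0 <= theta i w;
  times_nondegenerate : forall i, (P [set w | theta i w = 0%R] < 1)%E;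
  times_independent : independent_RVs theta;
  claims_times_independent : independent_sequences Z theta }.

Local Open Scope ereal_scope.

(* Possibly +oo: nothing prevents the arrival times from accumulating. *)
Definition renewal_count (theta : nat -> T -> R) (t : R) (w : T) : \bar R :=
  \sum_(0 <= n <oo)
    (\1_[set w' | (\sum_(i < n.+1) theta i w' <= t)%R] w)%:E.

(* The sum over 1 <= i <= Theta(t), which is an infinite series when
   Theta(t) = +oo; hence the extended-real value. *)
Definition aggregate_claims (Z theta : nat -> T -> R) (t : R) (w : T) : \bar R :=
  \sum_(0 <= i <oo | i.+1%:R%:E <= renewal_count theta t w) (Z i w)%:E.

Definition surplus (p : R) (Z theta : nat -> T -> R) (u t : R) (w : T) : \bar R :=
  (u + p * t)%:E - aggregate_claims Z theta t w.

Definition ruin_event (p : R) (Z theta : nat -> T -> R) (u : R) : set T :=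
  [set w | ereal_inf [set surplus p Z theta u t w | t in [set t | (0 <= t)%R]]
           < 0].

Definition ruin_probability (p : R) (Z theta : nat -> T -> R) (u : R) : \bar R :=
  P (ruin_event p Z theta u).

Definition average (n : nat) (x : nat -> \bar R) : \bar R :=
  (n%:R^-1)%:E * \sum_(i < n) x i.

Definition exp_tail_moment (h : R) (X : T -> R) : \bar R :=
  P [set w | (X w <= 0)%R] +
  'E_P[fun w => (expR (h * X w) * \1_[set w' | (0 < X w')%R] w)%R].

Definition lower_tail_moment (c : R) (X : T -> R) : \bar R :=
  'E_P[fun w => (`|X w| * \1_[set w' | (X w' <= - c)%R] w)%R].

End risk_model.

Section ruin_event.
Context {d : measure_display} {T : measurableType d} {R : realType}.
Variables (p : R) (Z theta : nat -> T -> R).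
Hypothesis p_gt0 : 0 < p.
Hypothesis Z_ge0 : forall i w, 0 <= Z i w.
Hypothesis theta_ge0 : forall i w, 0 <= theta i w.

Let arrival n w := \sum_(i < n) theta i w.

Let arrival_le m n w : (m <= n)%N -> arrival m w <= arrival n w.
Proof.
move=> /subnKC <-; elim: (n - m)%N => [|k IH]; first by rewrite addn0.
by rewrite addnS /arrival big_ord_recr/= (le_trans IH)// lerDl.
Qed.

Lemma le_renewal_count n t w :
  (n.+1%:R%:E <= renewal_count theta t w)%E = (\sum_(i < n.+1) theta i w <= t).
Proof.
rewrite -/(arrival n.+1 w).
have i0 k : (0 <= (\1_[set w' | arrival k.+1 w' <= t] w)%:E :> \bar R)%E.
  by rewrite lee_fin indicE.
have [le_t|gt_t] := leP (arrival n.+1 w) t.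
  apply/idP; rewrite /renewal_count.
  apply: (@le_trans _ _ (\sum_(0 <= k < n.+1)
      (\1_[set w' | arrival k.+1 w' <= t] w)%:E)%E); last first.
    by apply: nneseries_lim_ge => k _ _; exact: i0.
  rewrite sumEFin lee_fin [leRHS](_ : _ = \sum_(0 <= k < n.+1) 1%R).
    by rewrite big_mkord sumr_const card_ord.
  rewrite !big_mkord; apply: eq_bigr => k _; rewrite indicE mem_set//=.
  by apply: le_trans le_t; apply: arrival_le; rewrite ltn_ord.
apply/negP/negP; rewrite -ltNge /renewal_count.
rewrite (@nneseries_split _ _ 0 n)//.
rewrite eseries0 ?adde0; last first.
  move=> k nk _; rewrite indicE memNset//= => kt.
  have := le_trans (arrival_le w (n := k.+1) (m := n.+1) nk) kt.
  by rewrite leNgt gt_t.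
rewrite sumEFin lte_fin (@le_lt_trans _ _ n%:R)// ?ltr_nat//.
rewrite add0n big_mkord (@le_trans _ _ (\sum_(k < n) 1))//.
  by apply: ler_sum => k _; rewrite indicE lern1 leq_b1.
by rewrite sumr_const card_ord.
Qed.

(* The first passage happens at an arrival time, so the infimum over t >= 0 may
   be replaced by the supremum of the random walk; in particular the ruin event
   is measurable when the Z_i and theta_i are. *)
Lemma ruin_eventE u : 0 <= u -> ruin_event p Z theta u =
  [set w | (u%:E < ereal_sup [set (\sum_(k < n) (Z k w - p * theta k w))%:E
                             | n in [set n | (1 <= n)%N]])%E].
Proof.
move=> u0; apply/seteqP; split => w /=.
  move=> /ereal_inf_lt[_ [t /= t0 <-]].
  rewrite /surplus sube_lt0 ?fin_numE// /aggregate_claims => ut.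
  have [n un] : exists n, ((u + p * t)%:E <
      \sum_(0 <= i < n | i.+1%:R%:E <= renewal_count theta t w) (Z i w)%:E)%E.
    apply: contrapT => /forallNP H; move: ut; apply/negP; rewrite -leNgt.
    apply: lime_le.
      by apply: is_cvg_nneseries => *; rewrite lee_fin.
    by apply: nearW => n; rewrite leNgt; apply/negP.
  have [m mt Em] : exists2 m, arrival m w <= t &
      (\sum_(0 <= i < n | i.+1%:R%:E <= renewal_count theta t w) (Z i w)%:E)%E
      = (\sum_(i < m) Z i w)%:E.
    elim: {un} n => [|n [m mt IH]].
      by exists 0%N; rewrite ?big_nil /arrival ?big_ord0.
    have [nt|nt] := boolP (arrival n.+1 w <= t).
      exists n.+1 => //; rewrite big_mkord -sumEFin; apply: eq_bigl => i.
      by rewrite le_renewal_count (le_trans _ nt)// arrival_le.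
    exists m => //; rewrite big_mkcond big_nat_recr//= -big_mkcond/= IH.
    by rewrite le_renewal_count -/(arrival n.+1 w) (negbTE nt) adde0.
  move: un; rewrite Em lte_fin => um.
  have Tm : p * arrival m w <= p * t by rewrite ler_pM2l.
  case: m mt Em um Tm => [|m] mt Em um Tm.
    move: um; rewrite big_ord0 ltNge addr_ge0// mulr_ge0// ltW//.
  apply: (@lt_le_trans _ _ (\sum_(k < m.+1) (Z k w - p * theta k w))%:E).
    rewrite lte_fin sumrB -mulr_sumr ltrBrDr (le_lt_trans _ um)// lerD2l//.
  by apply: ereal_sup_ubound; exists m.+1.
move=> /ereal_sup_gt[_ [n /= n1 <-]]; rewrite lte_fin => un.
apply: (@le_lt_trans _ _ (surplus p Z theta u (arrival n w) w)).
  apply: ereal_inf_lbound; exists (arrival n w) => //=.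
  by apply: sumr_ge0 => i _.
rewrite /surplus sube_lt0 ?fin_numE// /aggregate_claims.
apply: (@lt_le_trans _ _ (\sum_(i < n) Z i w)%:E).
  by rewrite lte_fin -ltrBrDr /arrival mulr_sumr -sumrB.
apply: (@le_trans _ _ (\sum_(0 <= i < n | (i.+1%:R%:E <=
    renewal_count theta (arrival n w) w)%E) (Z i w)%:E)%E); last first.
  by apply: nneseries_lim_ge => k _ _; rewrite lee_fin.
rewrite big_mkord -sumEFin le_eqVlt; apply/orP; left; apply/eqP.
by apply: eq_bigl => i; rewrite le_renewal_count arrival_le.
Qed.
End ruin_event.

(* Equals d2 + d2^2 + ... + d2^(b-1) when 1 <= d2. *)
Definition S_const {R : realType} (b : nat) (d2 : R) : R :=
  if 1 < d2 then d2 * ((d2 ^+ b.-1 - 1) / (d2 - 1)) else b.-1%:R.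

Definition Delta_const {R : realType} (a c eps h d1 delta : R) : R :=
  - (eps + delta * h * d1 * Num.max (c ^+ 2 / 2) (2 / h ^+ 2) - a).

Definition c1_const {R : realType} (b : nat) (h d2 delta Delta : R) : R :=
  S_const b d2 +
  expR (- (delta * h * Delta * b%:R)) / (1 - expR (- (delta * h * Delta))).

(* Main.v *)
(* Put y = delta h.  Ruin means that some partial sum
   xi_1 + ... + xi_n exceeds u, so by the union bound and Chernoff's inequality
   psi(u) <= e^{-y u} sum_n prod_{i <= n} E e^{y xi_i}, and by the arithmetic-
   geometric mean inequality each product is at most the n-th power of the
   average of the E e^{y xi_i}.  For n < b that average is at most d2, because
   e^{y x} <= 1_{x <= 0} + e^{h x} 1_{x > 0}.  For n >= b a second order
   expansion of e^{y x}, cut at -c and at 0, bounds it by 1 - y Delta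
   <= e^{-y Delta}, and the resulting series is geometric. *)
Require Import Defs.
From HB Require Import structures.
From mathcomp Require Import all_boot all_order all_algebra.
From mathcomp Require Import all_classical all_reals all_analysis.
From mathcomp Require Import measurable_realfun.
From mathcomp Require Import lra ring.

Import Order.TTheory GRing.Theory Num.Theory.
Import numFieldNormedType.Exports HBNNSimple.

Local Open Scope classical_set_scope.
Local Open Scope ring_scope.

(** * Pointwise inequalities for the exponential *)

Section exponential_bounds.
Context {R : realType}.
Implicit Types x y c h : R.

(** The difference [f] of the two sides has derivative [expR z - (1 + z) >= 0] and vanishes at 0. *)
Lemma expR_le_quad_npos x : x <= 0 -> expR x <= 1 + x + x ^+ 2 / 2.
Proof.
move=> x0; pose f x : R := expR x - (1 + x + x ^+ 2 / 2).
have df (z : R) : is_derive z (1 : R) f (expR z - (1 + z)).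
  apply: is_derive_eq.
  rewrite /= !scaler1 ?scaler0 /GRing.scale/=; lra.
have : f x <= f 0.
  apply: (@ger0_derive1_ndecr _ f x 0) => //.
  - move=> z _; rewrite derive1E (@derive_val _ _ _ _ _ _ _ (df z)) subr_ge0.
    exact: expR_ge1Dx.
  - apply: continuous_subspaceT => z.
    by apply/differentiable_continuous/derivable1_diffP; have [] := df z.
by rewrite /f expR0 expr0n/=; lra.
Qed.

(** The difference of the two sides vanishes at 0, and its derivative [1 - (1 - z) * expR z + z ^+ 2
    / 2 * expR z] is nonnegative because [1 - z <= expR (- z)]. *)
Lemma expR_le_quad_nneg x : 0 <= x -> expR x <= 1 + x + x ^+ 2 / 2 * expR x.
Proof.
move=> x0; pose f x : R := 1 + x + x ^+ 2 / 2 * expR x - expR x.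
have df (z : R) : is_derive z (1 : R) f (1 + (z + z ^+ 2 / 2) * expR z - expR z).
  apply: is_derive_eq.
  rewrite /= !scaler1 ?scaler0 /GRing.scale/=; lra.
have : f 0 <= f x.
  apply: (@ger0_derive1_ndecr _ f 0 x) => //.
  - move=> z; rewrite in_itv/= => /andP[z0 _].
    rewrite derive1E (@derive_val _ _ _ _ _ _ _ (df z)).
    have ez := expR_gt0 z.
    have : (1 - z) * expR z <= 1.
      by rewrite -ler_pdivlMr// div1r -expRN expR_ge1Dx.
    have : 0 <= z ^+ 2 / 2 * expR z by rewrite mulr_ge0 ?divr_ge0 ?sqr_ge0// ltW.
    lra.
  - apply: continuous_subspaceT => z.
    by apply/differentiable_continuous/derivable1_diffP; have [] := df z.
by rewrite /f expR0 expr0n/=; lra.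
Qed.

(** With [e = expR (x / 4) >= 1 + x / 4], the identity [(1 + x / 4) ^+ 2 = x + (1 - x / 4) ^+ 2]
    gives [x <= e ^+ 2]; squaring once more gives the claim. *)
Lemma sqr_le_expR x : 0 <= x -> x ^+ 2 <= expR x.
Proof.
move=> x0; have -> : expR x = expR (x / 4) ^+ 4 by rewrite -expRM_natl; congr expR; lra.
have := expR_ge1Dx (x / 4); set e := expR _ => e1.
have : x <= e ^+ 2.
  have : (1 + x / 4) ^+ 2 <= e ^+ 2 by rewrite lerXn2r ?nnegrE; lra.
  by have := sqr_ge0 (1 - x / 4); lra.
by rewrite (exprM _ 2 2) => ?; rewrite lerXn2r ?nnegrE ?sqr_ge0.
Qed.

(* The last term comes from [expR z <= 1 + z + z ^+ 2 / 2 * max 1 (expR z)] at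
   [z = y * x]; for [x > 0] and [y <= h / 2] the factor [x ^+ 2] is absorbed by
   the unused half [expR (h * x / 2)] of the exponential weight. *)
Lemma expR_tilt_le (y c h x : R) : 0 <= y -> y <= h / 2 -> 0 < c -> 0 < h ->
  expR (y * x) <= 1 + y * x + y * (`|x| * (x <= - c)%R%:R) +
    y ^+ 2 * Num.max (c ^+ 2 / 2) (2 / h ^+ 2) *
      ((x <= 0)%R%:R + expR (h * x) * (0 < x)%R%:R).
Proof.
move=> y0 yh c0 h0; set M := Num.max _ _.
have M1 : c ^+ 2 / 2 <= M by rewrite le_max lexx.
have M2 : 2 / h ^+ 2 <= M by rewrite le_max lexx orbT.
have y2 := sqr_ge0 y.
have M0 : 0 <= y ^+ 2 * M by rewrite mulr_ge0// (le_trans _ M1)// divr_ge0// sqr_ge0.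
have [x0|x0] := leP x 0; last first.
  have -> : x <= - c = false by apply/negbTE; rewrite -ltNge; lra.
  have yx0 : 0 <= y * x by rewrite mulr_ge0// ltW.
  have hx0 : 0 <= h * x / 2 by rewrite divr_ge0// mulr_ge0// ltW.
  rewrite /= mulr0 mulr0 addr0 add0r mulr1.
  apply: (le_trans (expR_le_quad_nneg _ yx0)); rewrite lerD2l.
  have eyx : expR (y * x) <= expR (h * x / 2).
    by rewrite ler_expR mulrAC ler_wpM2r// ltW.
  have hx : h ^+ 2 * x ^+ 2 / 4 <= expR (h * x / 2).
    by have := sqr_le_expR _ hx0; rewrite !expr_div_n exprMn; lra.
  have -> : expR (h * x) = expR (h * x / 2) * expR (h * x / 2).
    by rewrite -expRD; congr expR; lra.
  have e0 := expR_gt0 (y * x); move: eyx hx e0.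
  set E := expR (h * x / 2); set F := expR _ => FE hE F0.
  apply: (@le_trans _ _ (y ^+ 2 * (2 / h ^+ 2) * (E * E))); last first.
    by rewrite ler_wpM2r ?mulr_ge0 ?ler_wpM2l//; lra.
  have -> : (y * x) ^+ 2 / 2 * F = y ^+ 2 * (2 / h ^+ 2) * (h ^+ 2 * x ^+ 2 / 4 * F).
    by field; rewrite gt_eqF.
  rewrite ler_wpM2l//; first by rewrite mulr_ge0// divr_ge0// sqr_ge0.
  by rewrite ler_pM// ?(ltW F0)// divr_ge0// mulr_ge0// sqr_ge0.
rewrite mulr0 addr0 mulr1.
(* For [x <= - c] the term in the absolute value of [x] cancels [y * x], and the remaining 1 already
   dominates. For [- c < x <= 0] the quadratic expansion suffices, since [x ^+ 2 <= c ^+ 2]. *)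
have [xc|xc] := leP x (- c).
  rewrite mulr1 ler0_norm// mulrN addrK.
  by rewrite (@le_trans _ _ 1) ?lerDl// -expR0 ler_expR mulr_ge0_le0.
rewrite mulr0 mulr0 addr0.
apply: (le_trans (expR_le_quad_npos _ _)); first by rewrite mulr_ge0_le0.
rewrite lerD2l exprMn -mulrA ler_wpM2l// (le_trans _ M1)// ler_wpM2r//.
by rewrite -sqrrN; nra.
Qed.

Lemma expR_le_tail (y h x : R) : 0 <= y -> y <= h ->
  expR (y * x) <= (x <= 0)%R%:R + expR (h * x) * (0 < x)%R%:R.
Proof.
move=> y0 yh; have [x0|x0] := leP x 0.
  by rewrite mulr0 addr0 -expR0 ler_expR mulr_ge0_le0.
by rewrite mulr1 add0r ler_expR ler_wpM2r// ltW.
Qed.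

End exponential_bounds.

(** * Expectation of a product of two independent variables *)

Section independent_product.
Context {d : measure_display} {T : measurableType d} {R : realType}.
Variable P : probability T R.
Local Open Scope ereal_scope.
Implicit Types W X Y : T -> R.

(* By monotone convergence along simple functions of [Y], it is enough to test
   [Y] through indicators of measurable sets. *)
Lemma expectationM_indic W Y :
  measurable_fun setT W -> measurable_fun setT Y ->
  (forall w, 0 <= W w)%R -> (forall w, 0 <= Y w)%R ->
  'E_P[W] < +oo ->
  (forall A, measurable A ->
    'E_P[fun w => (W w * \1_A (Y w))%R] = 'E_P[W] * P (Y @^-1` A)) ->
  'E_P[fun w => (W w * Y w)%R] = 'E_P[W] * 'E_P[Y].
Proof.
move=> mW mY W0 Y0; rewrite unlock => EW WA.
set EWE := \int[P]_w (W w)%:E in EW WA *.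
have EW0 : 0 <= EWE by apply: integral_ge0 => w _; rewrite lee_fin.
have EWfin : EWE \is a fin_num by rewrite ge0_fin_numE.
(* Approximation by simple functions requires a nonnegative function on the whole line; the absolute
   value agrees with the identity on the values of [Y]. *)
pose N (r : R) : \bar R := `|r|%:E.
have mN : measurable_fun setT N.
  by apply/measurable_EFinP; exact: normr_measurable.
have N0 r : [set: R] r -> 0 <= N r by rewrite lee_fin.
pose g := nnsfun_approx measurableT mN.
have mgY n : measurable_fun setT (fun w => g n (Y w)).
  exact: measurableT_comp.
(* Linearity over the level sets of [f] reduces this identity to [WA]. *)
have simple (f : {nnsfun R >-> R}) :
    \int[P]_w (W w * f (Y w))%:E = EWE * \int[P]_w (f (Y w))%:E.
  have mI r : measurable_fun setT (fun w => (\1_(f @^-1` [set r]) (Y w) : R)).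
    by apply: measurableT_comp => //; exact: measurable_indic.
  have E1 w : (f (Y w))%:E =
      \sum_(r \in range f) (r%:E * (\1_(f @^-1` [set r]) (Y w))%:E).
    by rewrite fimfunE -fsumEFin.
  under [in RHS]eq_integral do rewrite E1.
  transitivity (\int[P]_w \sum_(r \in range f)
      ((W w)%:E * (r%:E * (\1_(f @^-1` [set r]) (Y w))%:E))).
    apply: eq_integral => w _; rewrite EFinM E1 ge0_mule_fsumr// => r.
    exact: nnfun_muleindic_ge0.
  rewrite !ge0_integral_fsum//; last 4 first.
  - by move=> r; apply/measurable_EFinP/measurable_funM.
  - by move=> r w _; exact: nnfun_muleindic_ge0.
  - by move=> r; apply/measurable_EFinP/measurable_funM => //; exact/measurable_funM.
  - move=> r w _; apply: mule_ge0; first by rewrite lee_fin.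
    exact: nnfun_muleindic_ge0.
  rewrite ge0_mule_fsumr; last first.
    by move=> r; apply: integral_ge0 => w _; exact: nnfun_muleindic_ge0.
  apply: eq_fsbigr => r; rewrite inE => -[t _ <-].
  have ft : 0 <= (f t)%:E by rewrite lee_fin.
  set A := f @^-1` _.
  have mA : measurable A by exact: measurable_funPTI.
  transitivity (\int[P]_w ((f t)%:E * (W w * \1_A (Y w))%:E)).
    by apply: eq_integral => w _; rewrite muleCA -EFinM.
  rewrite [in RHS]ge0_integralZl//; last by apply/measurable_EFinP/mI.
  rewrite ge0_integralZl//; last 2 first.
  - by apply/measurable_EFinP/measurable_funM => //; exact: mI.
  - by move=> w _; rewrite lee_fin mulr_ge0.
  rewrite WA// muleCA; congr (_ * (_ * _)).
  transitivity (\int[P]_w (\1_(Y @^-1` A) w)%:E); last by [].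
  by rewrite integral_indic// ?setIT// -[X in measurable X]setTI; exact: mY.
have ndg w : {homo (fun n => g n (Y w)) : m n / (m <= n)%N >-> (m <= n)%R}.
  by move=> m n mn; exact/lefP/nd_nnsfun_approx.
have limg w : (EFin \o g ^~ (Y w)) x @[x --> \oo] --> (Y w)%:E.
  have := @cvg_nnsfun_approx _ _ _ _ measurableT _ mN N0 (Y w) Logic.I.
  by rewrite /N ger0_norm.
have cvgY : \int[P]_w (g n (Y w))%:E @[n --> \oo] --> \int[P]_w (Y w)%:E.
  under [in X in _ --> X]eq_integral => w _ do rewrite -(cvg_lim _ (limg w))//.
  apply: cvg_monotone_convergence => //.
  - by move=> n; exact/measurable_EFinP.
  - by move=> n w _; rewrite lee_fin.
  - by move=> w _ m n mn; rewrite lee_fin ndg.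
have cvgWY : \int[P]_w (W w * g n (Y w))%:E @[n --> \oo] -->
    \int[P]_w (W w * Y w)%:E.
  have limW w : (fun n => (W w * g n (Y w))%:E) x @[x --> \oo] --> (W w * Y w)%:E.
    exact: (@cvgeZl _ _ _ _ _ (W w)%:E isT (limg w)).
  under [in X in _ --> X]eq_integral => w _ do rewrite -(cvg_lim _ (limW w))//.
  apply: cvg_monotone_convergence => //.
  - by move=> n; exact/measurable_EFinP/measurable_funM.
  - by move=> n w _; rewrite lee_fin mulr_ge0.
  - by move=> w _ m n mn; rewrite lee_fin ler_wpM2l// ndg.
(* The factor [EWE] is finite, so it passes through the limit; by [simple] both monotone limits are
   then limits of the same sequence. *)
have := cvgeZl EWfin cvgY.
under eq_cvg do rewrite -simple.
by move/(cvg_unique _ cvgWY) => ->.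
Qed.

(** [expectationM_indic] is applied twice: first to replace [Y] by an indicator, then, with that
    indicator as the weight, to replace [X]. What is left is the product rule for events. *)
Lemma expectationM_indep X Y :
  measurable_fun setT X -> measurable_fun setT Y ->
  (forall w, 0 <= X w)%R -> (forall w, 0 <= Y w)%R -> 'E_P[X] < +oo ->
  (forall A B, measurable A -> measurable B ->
    P (X @^-1` A `&` Y @^-1` B) = P (X @^-1` A) * P (Y @^-1` B)) ->
  'E_P[fun w => (X w * Y w)%R] = 'E_P[X] * 'E_P[Y].
Proof.
move=> mX mY X0 Y0 EX XY.
apply: expectationM_indic => // B mB.
have mYB : measurable (Y @^-1` B) by rewrite -[X in measurable X]setTI; exact: mY.
have EYB : 'E_P[fun w => \1_B (Y w)] = P (Y @^-1` B).
  by rewrite unlock; have := integral_indic P measurableT mYB; rewrite setIT => <-.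
rewrite -EYB muleC.
rewrite (_ : (fun w => _) = (fun w => (\1_B (Y w) * X w)%R)); last first.
  by apply/funext => w; rewrite mulrC.
apply: expectationM_indic => //.
- by apply: measurableT_comp => //; exact: measurable_indic.
- by rewrite EYB (le_lt_trans (probability_le1 _ _))// ltry.
move=> A mA; have mXA : measurable (X @^-1` A) by rewrite -[X in measurable X]setTI; exact: mX.
rewrite EYB muleC -XY// unlock.
have := integral_indic P measurableT (measurableI _ _ mXA mYB).
rewrite setIT => <-; apply: eq_integral => w _.
by rewrite setIC indicI.
Qed.

End independent_product.

(** * Product rule for finitely many independent variables *)

Section independent_family.
Context {d : measure_display} {T : measurableType d} {R : realType}.
Variable P : probability T R.
Local Open Scope ereal_scope.

Lemma prod_indic (K : seq nat) (A : nat -> set T) (w : T) :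
  (\prod_(i <- K) (\1_(A i) w : R))%R = \1_(\bigcap_(i in [set` K]) A i) w.
Proof.
rewrite indicE; have [|] := boolP (w \in _).
  rewrite inE => /= Aw; rewrite big_seq big1// => i iK.
  by rewrite indicE mem_set//; exact: Aw.
move=> /negP; rewrite inE /bigcap/= => /existsNP[i] /not_implyP[iK Aiw].
by apply/eqP; rewrite prodf_seq_eq0; apply/hasP; exists i => //=; rewrite indicE memNset.
Qed.

(* The factors are turned into indicators one at a time, which reduces the
   claim to the product rule for events. *)
Lemma expectation_prod_indic (X : nat -> {RV P >-> R}) (f : nat -> R -> R) :
  independent_RVs X -> (forall i, measurable_fun setT (f i)) ->
  (forall i x, 0 <= f i x)%R ->
  (forall i, 'E_P[f i \o X i] < +oo) ->
  forall (J K : seq nat) (A : nat -> set R), uniq (J ++ K) ->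
    (forall i, measurable (A i)) ->
  'E_P[fun w => ((\prod_(i <- J) f i (X i w)) *
                 (\prod_(i <- K) \1_(A i) (X i w)))%R] =
  (\prod_(i <- J) 'E_P[f i \o X i]) * (\prod_(i <- K) P (X i @^-1` A i)).
Proof.
move=> iX mf f0 Efoo; elim=> [|j J IH] K A uJK mA.
  rewrite big_nil mul1e -iX//.
  have mI : measurable (\bigcap_(i in [set` K]) (X i @^-1` A i)).
    by apply: bigcap_measurableType => // i _; exact: measurable_funPTI.
  have := integral_indic P measurableT mI; rewrite setIT => <-; rewrite unlock.
  by apply: eq_integral => w _; rewrite big_nil mul1r -prod_indic.
(* Moving [j] from the first list to the second keeps the concatenation free of duplicates, so the
   induction hypothesis applies to [J] and [j :: K]. *)
have {uJK}[uJK' uJK jJ jK] :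
    [/\ uniq (J ++ j :: K), uniq (J ++ K), j \notin J & j \notin K].
  move: uJK; rewrite -cat1s -catA (perm_uniq (_ : perm_eq _ (J ++ j :: K))); last first.
    by rewrite perm_catCA.
  by move=> u; move: (u); rewrite !cat_uniq/= negb_or => /and3P[-> /andP[-> ->]] /andP[-> ->].
pose W w : R := ((\prod_(i <- J) f i (X i w)) * (\prod_(i <- K) \1_(A i) (X i w)))%R.
have mfX i : measurable_fun setT (f i \o X i) by exact: measurableT_comp.
have mIX i (B : set R) : measurable B -> measurable_fun setT (fun w => \1_B (X i w) : R).
  by move=> mB; apply: measurableT_comp => //; exact: measurable_indic.
have mW : measurable_fun setT W.
  apply: measurable_funM; apply: measurable_prod => i _; [exact: mfX|exact: mIX].
have W0 w : (0 <= W w)%R by rewrite mulr_ge0// prodr_ge0.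
have E0 i : 0 <= 'E_P[f i \o X i] by apply: expectation_ge0 => w /=.
have EW : 'E_P[W] < +oo.
  rewrite -ge0_fin_numE ?expectation_ge0// IH//.
  rewrite fin_numM ?prode_fin_num// => i _; first by rewrite ge0_fin_numE.
  by rewrite fin_num_measure//; exact: measurable_funPTI.
transitivity ('E_P[fun w => (W w * (f j \o X j) w)%R]).
  by congr expectation; apply/funext => w /=; rewrite big_cons /W; ring.
rewrite (expectationM_indic _ _ _ mW (mfX j))//; last 2 first.
  by move=> w /=.
  move=> B mB.
  (* The indicator of [B] at [f j (X j)] becomes the factor attached to [j]; since [j] is not in
     [K], the sets attached to [K] are unchanged. *)
  pose A' i := if i == j then f j @^-1` B else A i.
  have mA' i : measurable (A' i).
    rewrite /A'; case: eqP => // _.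
    by rewrite -[X in measurable X]setTI; exact: mf.
  have A'E : {in K, A' =1 A}.
    by move=> i iK; rewrite /A'; case: eqP => // ij; rewrite -ij iK in jK.
  transitivity ('E_P[fun w => ((\prod_(i <- J) f i (X i w)) *
                 (\prod_(i <- j :: K) \1_(A' i) (X i w)))%R]).
    congr expectation; apply/funext => w /=; rewrite big_cons /W -mulrA; congr (_ * _)%R.
    rewrite mulrC /A' eqxx; congr (_ * _)%R.
    by apply: eq_big_seq => i iK; rewrite -/(A' i) A'E.
  rewrite IH// IH// big_cons /A' eqxx muleA muleAC; congr (_ * _ * _).
  by apply: eq_big_seq => i iK; rewrite -/(A' i) A'E.
by rewrite /W IH// big_cons muleC muleA.
Qed.

Lemma expectation_prod (X : nat -> {RV P >-> R}) (f : nat -> R -> R) :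
  independent_RVs X -> (forall i, measurable_fun setT (f i)) ->
  (forall i x, 0 <= f i x)%R -> (forall i, 'E_P[f i \o X i] < +oo) ->
  forall n, 'E_P[fun w => (\prod_(i < n) f i (X i w))%R] =
            \prod_(i < n) 'E_P[f i \o X i].
Proof.
move=> iX mf f0 fX n.
have := @expectation_prod_indic X f iX mf f0 fX (index_iota 0 n) [::] (fun=> setT).
rewrite cats0 iota_uniq big_nil mule1 big_mkord => <-//.
by congr expectation; apply/funext => w; rewrite big_nil mulr1 big_mkord.
Qed.

End independent_family.

(** * Exponential moments of the random walk *)

Section exponential_moments.
Context {d : measure_display} {T : measurableType d} {R : realType}.
Variable P : probability T R.
Local Open Scope ereal_scope.

(** Independence of two sequences is stated through generated sigma-algebras. Equipping [T] with the
    one generated by [X] makes every [X i] measurable, hence also this function of finitely many of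
    them. *)
Lemma sigma_RVs_expR_sum (X : nat -> {RV P >-> R}) (s : seq nat) (y : R) (A : set R) :
  measurable A ->
  sigma_RVs X ((fun w => expR (y * \sum_(i <- s) X i w)) @^-1` A).
Proof.
move=> mA; rewrite /sigma_RVs.
set G := \bigcup_i _.
have mX i : @measurable_fun _ _ (g_sigma_algebraType G) R setT (X i).
  move=> _ B mB; apply: sub_gen_smallest; exists i => //.
  by exists B.
have mS : @measurable_fun _ _ (g_sigma_algebraType G) R setT
    (fun w => expR (y * \sum_(i <- s) X i w)).
  apply: measurableT_comp => //; apply: measurable_funM => //.
  exact: measurable_sum.
by have := mS measurableT A mA; rewrite setTI.
Qed.

Lemma measurable_expR_sum (X : nat -> {RV P >-> R}) (s : seq nat) (y : R) :
  measurable_fun setT (fun w => expR (y * \sum_(i <- s) X i w)).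
Proof.
apply: measurableT_comp => //; apply: measurable_funM => //.
exact: measurable_sum.
Qed.

(** Finiteness is required only of the factor in [Y]: for the inter-occurrence times it is
    immediate, while for the claims it is deduced afterwards from this identity. *)
Lemma expectation_expR_indep (X Y : nat -> {RV P >-> R}) (r s : seq nat) (x y : R) :
  independent_sequences X Y ->
  'E_P[fun w => expR (y * \sum_(i <- s) Y i w)] < +oo ->
  'E_P[fun w => expR (x * \sum_(i <- r) X i w + y * \sum_(i <- s) Y i w)] =
  'E_P[fun w => expR (x * \sum_(i <- r) X i w)] *
  'E_P[fun w => expR (y * \sum_(i <- s) Y i w)].
Proof.
move=> XY EY; rewrite muleC -(@expectationM_indep _ _ _ P)//.
- by congr expectation; apply/funext => w; rewrite expRD mulrC.
- exact: measurable_expR_sum.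
- exact: measurable_expR_sum.
- move=> A B mA mB; rewrite setIC muleC; apply: XY; exact: sigma_RVs_expR_sum.
Qed.

(** A zero integral would make the positive function [expR (X w)] vanish almost everywhere, so that
    the whole space would be null. *)
Lemma expectation_expR_gt0 (X : {RV P >-> R}) : 0 < 'E_P[fun w => expR (X w)].
Proof.
rewrite lt_neqAle expectation_ge0 ?andbT; last by move=> w; exact: expR_ge0.
have mX : measurable_fun setT (fun w => (expR (X w))%:E).
  by apply/measurable_EFinP; exact: measurableT_comp.
apply/eqP; rewrite unlock => /esym E0.
have : \int[P]_w `|(expR (X w))%:E| = 0.
  rewrite -[RHS]E0; apply: eq_integral => w _.
  by rewrite gee0_abs// lee_fin expR_ge0.
move/(ae_eq_integral_abs _ measurableT mX) => [N [mN N0 sub]].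
have : [set: T] `<=` N.
  move=> w _; apply: sub => /= /(_ Logic.I)[] /eqP.
  by rewrite gt_eqF// expR_gt0.
move=> /(le_measure P); rewrite !inE => /(_ measurableT mN).
rewrite [X in X <= _](@probability_setT _ _ _ P) [X in _ <= X]N0.
by rewrite lee_fin ler10.
Qed.

(** The exponential of the walk is split into its claim part and its time part, which are
    independent; each part is factored over the indices, and the factors are regrouped by index. *)
Lemma expectation_expR_walk (p y : R) (Z theta : nat -> {RV P >-> R}) :
  inhomogeneous_renewal_risk_model p Z theta -> (0 <= y)%R ->
  let xi k w : R := (Z k w - p * theta k w)%R in
  (forall i, 'E_P[fun w => expR (y * xi i w)] < +oo) ->
  forall n, 'E_P[fun w => expR (y * \sum_(i < n) xi i w)] =
            \prod_(i < n) 'E_P[fun w => expR (y * xi i w)].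
Proof.
move=> model y0 xi xioo n.
have [p0 Z0 iZ theta0 _ itheta iZtheta] := model.
pose q : R := (- (y * p))%R.
have q0 : (q <= 0)%R by rewrite oppr_le0 mulr_ge0// ltW.
have mexp (z : R) : measurable_fun setT (fun x : R => expR (z * x)).
  by apply: measurableT_comp => //; exact: measurable_funM.
(* Since [q <= 0] and the times are nonnegative, the exponential is at most 1. *)
have theta_oo s : 'E_P[fun w => expR (q * \sum_(i <- s) theta i w)] < +oo.
  apply: (@le_lt_trans _ _ 'E_P[cst 1%R]); last by rewrite expectation_cst ltry.
  apply: expectation_le => //.
  - exact: measurable_expR_sum.
  - apply: aeW => w /=; rewrite -expR0 ler_expR mulr_le0_ge0//.
    by apply: sumr_ge0 => i _; exact: theta0.
have single i : 'E_P[fun w => expR (y * xi i w)] =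
    'E_P[(fun x => expR (y * x)) \o Z i] * 'E_P[(fun x => expR (q * x)) \o theta i].
  have := expectation_expR_indep Z theta [:: i] [:: i] y q iZtheta (theta_oo [:: i]).
  have E1 (X : nat -> {RV P >-> R}) z :
      'E_P[fun w => expR (z * \sum_(j <- [:: i]) X j w)] =
      'E_P[(fun x => expR (z * x)) \o X i].
    by congr expectation; apply/funext => w; rewrite big_seq1.
  rewrite (E1 Z y) (E1 theta q) => <-; congr expectation; apply/funext => w.
  by rewrite !big_seq1 /xi /q; congr expR; ring.
have thetai i : 'E_P[(fun x => expR (q * x)) \o theta i] < +oo.
  have := theta_oo [:: i]; congr (_ < _); congr expectation.
  by apply/funext => w; rewrite big_seq1.
have thetagt i : 0 < 'E_P[(fun x => expR (q * x)) \o theta i].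
  have mq : measurable_fun setT (fun w => q * theta i w)%R by exact: measurable_funM.
  have := expectation_expR_gt0 (mfun_Sub (mem_set mq : _ \in mfun)).
  by [].
(* An infinite claim factor times the positive time factor would make the moment of [xi i] infinite,
   against [xioo]. *)
have Zoo i : 'E_P[(fun x => expR (y * x)) \o Z i] < +oo.
  rewrite ltey; apply: contraPneq (xioo i) => ZE.
  by rewrite single ZE gt0_mulye.
transitivity ('E_P[fun w => expR (y * \sum_(i <- index_iota 0 n) Z i w +
                                q * \sum_(i <- index_iota 0 n) theta i w)]).
  congr expectation; apply/funext => w; rewrite !big_mkord; congr expR.
  by rewrite /xi sumrB -mulr_sumr /q; ring.
rewrite expectation_expR_indep//.
have prodE (X : nat -> {RV P >-> R}) z :
    'E_P[fun w => expR (z * \sum_(i <- index_iota 0 n) X i w)] =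
    'E_P[fun w => (\prod_(i < n) expR (z * X i w))%R].
  by congr expectation; apply/funext => w; rewrite big_mkord mulr_sumr expR_sum.
rewrite (prodE Z y) (prodE theta q).
rewrite (expectation_prod _ Z (fun=> fun x => expR (y * x)))//.
rewrite (expectation_prod _ theta (fun=> fun x => expR (q * x)))//.
by rewrite -big_split/=; apply: eq_bigr => i _; rewrite single.
Qed.

End exponential_moments.

(** * Moments of a single step *)

Section tilted_moment.
Context {d : measure_display} {T : measurableType d} {R : realType}.
Variables (P : probability T R) (X : T -> R) (c h y : R).
Hypothesis mX : measurable_fun setT X.
Hypotheses (c0 : 0 < c) (h0 : 0 < h) (y0 : 0 <= y) (yh : y <= h / 2).

(** [tail] and [lower] are the integrands of [exp_tail_moment] and [lower_tail_moment], with
    booleans in place of set indicators to match the pointwise bounds. *)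
Let tail (w : T) : R := (X w <= 0)%R%:R + expR (h * X w) * (0 < X w)%R%:R.
Let lower (w : T) : R := `|X w| * (X w <= - c)%R%:R.

Let y_le_h : y <= h.
Proof. by rewrite (le_trans yh)// ler_pdivrMr// ler_peMr ?ltW// ltr1n. Qed.

Let mle (r : R) : measurable [set w | X w <= r].
Proof. by rewrite -[X in measurable X]setTI; exact: measurable_fun_le. Qed.

Let mgt0 : measurable [set w | 0 < X w].
Proof.
have := mX measurableT _ (measurable_itv `]0, +oo[); rewrite setTI.
by congr measurable; apply/funext => w /=; rewrite in_itv/= andbT.
Qed.

Let indicE_bool (p : T -> bool) w : \1_[set w' | p w'] w = (p w)%:R :> R.
Proof. by rewrite indicE; congr (nat_of_bool _)%:R; apply: asboolb. Qed.

Let mbool (p : T -> bool) : measurable [set w | p w] ->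
  measurable_fun setT (fun w => (p w)%:R : R).
Proof.
move=> mp; rewrite (_ : (fun w => _) = \1_[set w | p w]).
  exact: measurable_indic.
by apply/funext => w; rewrite indicE_bool.
Qed.

Let mexp (r : R) : measurable_fun setT (fun w => expR (r * X w)).
Proof. by apply: measurableT_comp => //; exact: measurable_funM. Qed.

Let mtail : measurable_fun setT tail.
Proof. by apply: measurable_funD; [|apply: measurable_funM => //]; exact: mbool. Qed.

Let mlower : measurable_fun setT lower.
Proof.
by apply: measurable_funM; [exact: measurableT_comp|exact: mbool].
Qed.

Let tail_ge0 w : 0 <= tail w.
Proof. by rewrite addr_ge0// mulr_ge0// expR_ge0. Qed.

Let lower_ge0 w : 0 <= lower w.
Proof. by rewrite mulr_ge0. Qed.

Let lowerE : lower_tail_moment P c X = (\int[P]_w (lower w)%:E)%E.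
Proof.
rewrite /lower_tail_moment unlock; apply: eq_integral => w _.
by rewrite indicE_bool.
Qed.

Let tailE : exp_tail_moment P h X = (\int[P]_w (tail w)%:E)%E.
Proof.
rewrite /exp_tail_moment unlock.
have := integral_indic P measurableT (mle 0); rewrite setIT => <-.
rewrite -ge0_integralD//; first last.
- by apply/measurable_EFinP/measurable_funM; [exact: mexp|exact: measurable_indic].
- by apply/measurable_EFinP; exact: measurable_indic.
by apply: eq_integral => w _; rewrite !indicE_bool.
Qed.

Lemma lower_tail_moment_ge0 : (0 <= lower_tail_moment P c X)%E.
Proof. by rewrite lowerE integral_ge0// => w _; rewrite lee_fin. Qed.

Lemma exp_tail_moment_ge0 : (0 <= exp_tail_moment P h X)%E.
Proof. by rewrite tailE integral_ge0// => w _; rewrite lee_fin. Qed.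

Hypothesis lower_fin : (lower_tail_moment P c X < +oo)%E.
Hypothesis tail_fin : (exp_tail_moment P h X < +oo)%E.

Let int_tail : P.-integrable setT (EFin \o tail).
Proof.
apply/integrableP; split; first exact/measurable_EFinP.
move: tail_fin; rewrite tailE; congr (_ < _)%E; apply: eq_integral => w _ /=.
by rewrite ger0_norm.
Qed.

Let int_lower : P.-integrable setT (EFin \o lower).
Proof.
apply/integrableP; split; first exact/measurable_EFinP.
move: lower_fin; rewrite lowerE; congr (_ < _)%E; apply: eq_integral => w _ /=.
by rewrite ger0_norm.
Qed.

Let int_cst (r : R) : P.-integrable setT (EFin \o (fun=> r)).
Proof. exact: finite_measure_integrable_cst. Qed.

Let intD (f g : T -> R) : P.-integrable setT (EFin \o f) ->
  P.-integrable setT (EFin \o g) -> P.-integrable setT (EFin \o (fun w => f w + g w)).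
Proof. exact: integrableD. Qed.

Let intZ (r : R) (f : T -> R) : P.-integrable setT (EFin \o f) ->
  P.-integrable setT (EFin \o (fun w => r * f w)).
Proof. exact: integrableZl. Qed.

(** The absolute value of [X] is at most [c + lower + h^-1 * tail]: [lower] covers [X <= - c], the
    constant [c] covers values in []- c, 0]], and positive values satisfy
    [h * X <= expR (h * X)]. *)
Let int_X : P.-integrable setT (EFin \o X).
Proof.
have int_dom := intD _ _ (intD _ _ (int_cst c) int_lower) (intZ h^-1 _ int_tail).
apply: le_integrable int_dom => //; first exact/measurable_EFinP.
move=> w _ /=; rewrite lee_fin [leRHS]ger0_norm; last first.
  by rewrite !addr_ge0// ?(ltW c0)// mulr_ge0// invr_ge0 ltW.
have ht : 0 <= h^-1 * tail w by rewrite mulr_ge0// invr_ge0 ltW.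
have [Xc|Xc] := leP (X w) (- c).
  have -> : lower w = `|X w| by rewrite /lower Xc mulr1.
  by rewrite addrAC lerDr addr_ge0// ltW.
have lw := lower_ge0 w; have [X0|X0] := leP (X w) 0.
  rewrite ler0_norm//; apply: (@le_trans _ _ c); first by rewrite lerNl ltW.
  by rewrite -addrA lerDl addr_ge0.
suff : X w <= h^-1 * tail w.
  move=> Xt; rewrite gtr0_norm// (le_trans Xt)// lerDr addr_ge0//; exact: ltW.
have -> : tail w = expR (h * X w) by rewrite /tail X0 leNgt X0 add0r mulr1.
rewrite mulrC ler_pdivlMr// mulrC.
by have := expR_ge1Dx (h * X w); lra.
Qed.

Let int_exp : P.-integrable setT (EFin \o (fun w => expR (y * X w))).
Proof.
apply: le_integrable int_tail => //; first exact/measurable_EFinP.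
move=> w _ /=; rewrite lee_fin !ger0_norm ?expR_ge0//.
exact: expR_le_tail.
Qed.

Lemma expectation_tilt_fin_num :
  'E_P[fun w => expR (y * X w)]%E \is a fin_num.
Proof. by rewrite unlock; exact: integrable_fin_num. Qed.

Lemma expectation_tails_fin_num : 'E_P[X]%E \is a fin_num.
Proof. by rewrite unlock; exact: integrable_fin_num. Qed.

Lemma expectation_tilt_le_tail :
  fine 'E_P[fun w => expR (y * X w)]%E <= fine (exp_tail_moment P h X).
Proof.
rewrite tailE unlock; apply: le_Rintegral => // w _.
exact: expR_le_tail.
Qed.

(** [expR_tilt_le] is integrated term by term, which the integrability of [X], [lower] and [tail]
    permits. *)
Lemma expectation_tilt_le :
  fine 'E_P[fun w => expR (y * X w)]%E <=
  1 + y * fine 'E_P[X]%E + y * fine (lower_tail_moment P c X) +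
  y ^+ 2 * Num.max (c ^+ 2 / 2) (2 / h ^+ 2) * fine (exp_tail_moment P h X).
Proof.
rewrite tailE lowerE unlock; set M := Num.max _ _.
apply: (@le_trans _ _ (\int[P]_w (1 + y * X w + y * lower w + y ^+ 2 * M * tail w))).
  apply: le_Rintegral => //; first by do 3?[apply: intD => //]; exact: intZ.
  by move=> w _; exact: expR_tilt_le.
have i1 := int_cst 1; have i2 := intZ y _ int_X; have i3 := intZ y _ int_lower.
have i4 := intZ (y ^+ 2 * M) _ int_tail.
have i12 := intD _ _ i1 i2; have i123 := intD _ _ i12 i3.
rewrite !RintegralD// !RintegralZl// Rintegral_cst//.
by rewrite [X in fine X](@probability_setT _ _ _ P) mul1r.
Qed.

End tilted_moment.

(** * Averages, geometric means and the geometric series *)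

Section averages.
Context {R : realType}.

(** A single infinite term among nonnegative ones makes the whole average infinite. *)
Lemma average_lt_pinfty (n i : nat) (x : nat -> \bar R) :
  (forall j, 0 <= x j)%E -> (average n x < +oo)%E -> (i < n)%N -> (x i < +oo)%E.
Proof.
move=> x0 xoo ni; have n0 : (0 : R) < n%:R by rewrite ltr0n (leq_ltn_trans _ ni).
rewrite ltey; apply: contraPneq xoo => xi.
rewrite /average (bigD1 (Ordinal ni))//= xi addye.
  by rewrite gt0_muley// lte_fin invr_gt0.
by rewrite gt_eqF// (lt_le_trans ltNy0)// sume_ge0.
Qed.

Lemma sum_fine_le_average (n : nat) (x : nat -> \bar R) (r : R) :
  (0 < n)%N -> (forall i, x i \is a fin_num) -> (average n x <= r%:E)%E ->
  \sum_(i < n) fine (x i) <= n%:R * r.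
Proof.
move=> n0 xfin; rewrite /average.
under eq_bigr do rewrite -(fineK (xfin _)).
by rewrite sumEFin -EFinM lee_fin ler_pdivrMl// ltr0n.
Qed.

Lemma prod_le_mean_expr (n : nat) (x : nat -> R) (r : R) :
  (0 < n)%N -> (forall i, 0 <= x i) -> \sum_(i < n) x i <= n%:R * r ->
  \prod_(i < n) x i <= r ^+ n.
Proof.
move=> n0 x0 xr; have [+ _] := @leif_AGM _ 'I_n predT (fun i => x i) (fun i _ => x0 i).
rewrite card_ord => /le_trans; apply.
have s0 : 0 <= \sum_(i < n) x i by exact: sumr_ge0.
have nr0 : (0 : R) < n%:R by rewrite ltr0n.
have sr : (\sum_(i < n) x i) / n%:R <= r by rewrite ler_pdivrMr// mulrC.
by rewrite lerXn2r ?nnegrE// ?(le_trans _ sr)// divr_ge0// ltW.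
Qed.

Lemma sum_expr_le_S_const (b N : nat) (D q : R) :
  (0 < b)%N -> 1 <= D -> 0 < q -> q < 1 ->
  \sum_(k < N) (if (k.+1 < b)%N then D ^+ k.+1 else q ^+ k.+1) <=
  S_const b D + q ^+ b / (1 - q).
Proof.
case: b => // b _ D1 q0 q1; rewrite /S_const/=.
have D0 : 0 <= D by rewrite (le_trans ler01).
(* From here [b] is the predecessor of the original constant. Extending the sum to [b + N]
   nonnegative terms allows a split at [b] whatever the size of [N]: first a finite sum of powers of
   [D], then a geometric sum with first term [q ^+ b.+1]. *)
apply: (@le_trans _ _ (\sum_(0 <= k < b + N)
    (if (k.+1 < b.+1)%N then D ^+ k.+1 else q ^+ k.+1))).
  rewrite -(big_mkord predT (fun k => if (k.+1 < b.+1)%N then D ^+ k.+1 else q ^+ k.+1)).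
  rewrite (@big_cat_nat _ _ _ N 0 (b + N))//= ?leq_addl// lerDl sumr_ge0// => k _.
  by case: ifP => _; rewrite exprn_ge0// ltW.
rewrite (@big_cat_nat _ _ _ b)//= ?leq_addr//; apply: lerD.
  rewrite big_mkord (eq_bigr (fun k : 'I_b => D * D ^+ k)); last first.
    by move=> k _; rewrite ltnS ltn_ord exprS.
  rewrite -mulr_sumr; case: ltP => [D1'|D1'].
    rewrite subrX1 mulrAC divff ?mul1r// subr_eq0.
    by rewrite gt_eqF.
  have -> : D = 1 by apply/eqP; rewrite eq_le D1 D1'.
  under eq_bigr do rewrite expr1n.
  by rewrite sumr_const card_ord mul1r.
have q1' : `|q| < 1 by rewrite gtr0_norm.
apply: le_trans (geometric_le_lim N _ q0 q1'); last by rewrite exprn_ge0// ltW.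
rewrite /series/= -{1}[b]add0n big_addn addKn.
rewrite (big_mkord predT (fun k => geometric (q ^+ b.+1) q k)) big_mkord.
apply: ler_sum => k _; rewrite ltnS ltnNge leq_addl/= -exprD.
by rewrite addSn addnC.
Qed.

End averages.

(** * Union bound and Chernoff's inequality for ruin *)

Section ruin_union_bound.
Context {d : measure_display} {T : measurableType d} {R : realType}.
Variable P : probability T R.
Local Open Scope ereal_scope.

Let S (p : R) (Z theta : nat -> {RV P >-> R}) n w : R :=
  (\sum_(k < n) (Z k w - p * theta k w))%R.

Let mS p Z theta n : measurable_fun setT (S p Z theta n).
Proof.
by apply: measurable_sum => k; apply: measurable_funB => //; exact: measurable_funM.
Qed.

Let mgt p Z theta u n : measurable [set w | (u < S p Z theta n w)%R].
Proof.
have := mS p Z theta n measurableT _ (measurable_itv `]u, +oo[); rewrite setTI.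
by congr measurable; apply/funext => w /=; rewrite in_itv/= andbT.
Qed.

(** A supremum exceeds [u] exactly when some term does. The countable union yields both the
    measurability of ruin and the union bound. *)
Let ruin_event_bigcup p u Z theta :
  inhomogeneous_renewal_risk_model p Z theta -> (0 <= u)%R ->
  ruin_event p Z theta u = \bigcup_n [set w | (u < S p Z theta n.+1 w)%R].
Proof.
move=> model u0; have [p0 Z0 _ theta0 _ _ _] := model.
rewrite ruin_eventE//; apply/seteqP; split=> w /=.
  move=> /ereal_sup_gt[_ [[//|n] /= _ <-]]; rewrite lte_fin => un.
  by exists n.
move=> [n _ /= un]; apply: (@lt_le_trans _ _ (S p Z theta n.+1 w)%:E).
  by rewrite lte_fin.
by apply: ereal_sup_ubound; exists n.+1.
Qed.

Lemma measurable_ruin_event (p u : R) (Z theta : nat -> {RV P >-> R}) :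
  inhomogeneous_renewal_risk_model p Z theta -> (0 <= u)%R ->
  measurable (ruin_event p Z theta u).
Proof.
by move=> model u0; rewrite ruin_event_bigcup//; exact: bigcup_measurable.
Qed.

Lemma ruin_probability_le_series (p y u : R) (Z theta : nat -> {RV P >-> R}) :
  inhomogeneous_renewal_risk_model p Z theta -> (0 < y)%R -> (0 <= u)%R ->
  ruin_probability P p Z theta u <=
  \sum_(0 <= n <oo)
    'E_P[fun w => expR (y * \sum_(k < n.+1) (Z k w - p * theta k w))] *
    (expR (- (y * u)))%:E.
Proof.
move=> model y0 u0.
have mruin := measurable_ruin_event p u Z theta model u0.
rewrite /ruin_probability; move: mruin; rewrite ruin_event_bigcup// => mruin.
apply: le_trans; first exact: generalized_Boole_inequality.
apply: lee_nneseries => // n _.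
have := chernoff (mfun_Sub (mem_set (mS p Z theta n.+1) : _ \in mfun)) u y0.
rewrite /mmt_gen_fun => le_chernoff.
rewrite (_ : (fun w => expR _) = expR \o y \o* S p Z theta n.+1); last first.
  by apply/funext => w /=; rewrite mulrC.
apply: le_trans; last exact: le_chernoff.
(* Chernoff's inequality concerns the event [u <= S], which contains the strict one. *)
apply: le_measure; rewrite ?inE//.
  have := mS p Z theta n.+1 measurableT _ (measurable_itv `[u, +oo[); rewrite setTI.
  by congr measurable; apply/funext => w /=; rewrite in_itv/= andbT.
by move=> w /=; exact: ltW.
Qed.

End ruin_union_bound.

(** * The exponential bound for the ruin probability *)

Theorem corollary2 (d : measure_display) (T : measurableType d) (R : realType)
    (P : probability T R) (p : R) (Z theta : nat -> {RV P >-> R})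
    (model : inhomogeneous_renewal_risk_model p Z theta)
    (a c eps h d1 d2 delta : R) (b : nat)
    (ha : 0 < a) (hb : (1 <= b)%N) (hc : 0 < c) (heps : 0 <= eps) (hh : 0 < h)
    (hd1 : 1 <= d1) (hd2 : 1 <= d2) :
  let xi (k : nat) (w : T) : R := Z k w - p * theta k w in
  (forall n, (b <= n)%N ->
    (average n (fun i => 'E_P[xi i]) <= (- a)%:E)%E) ->
  (ereal_sup [set average n (fun i => lower_tail_moment P c (xi i))
             | n in [set n | (b <= n)%N]] <= eps%:E)%E ->
  (ereal_sup [set average n (fun i => exp_tail_moment P h (xi i))
             | n in [set n | (b <= n)%N]] <= d1%:E)%E ->
  (\big[maxe/-oo]_(1 <= n < b) average n (fun i => exp_tail_moment P h (xi i))
     <= d2%:E)%E ->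
  0 < delta <= 1 / 2 ->
  let Delta := Delta_const a c eps h d1 delta in
  - Delta < 0 ->
  forall u : R, 0 <= u ->
    (ruin_probability P p Z theta u <=
      (Num.min 1 (c1_const b h d2 delta Delta * expR (- (delta * h * u))))%:E)%E.
Proof.
move=> xi Hmean Hlower Htail Htail' /andP[delta0 delta1] Delta Delta0 u u0.
rewrite EFin_min le_min; apply/andP; split.
  by apply: probability_le1; exact: measurable_ruin_event.
pose y := delta * h; pose M := Num.max (c ^+ 2 / 2) (2 / h ^+ 2).
have y0 : 0 < y by exact: mulr_gt0.
have yh : y <= h / 2 by have := ler_wpM2r (ltW hh) delta1; rewrite -/y; lra.
have mxi i : measurable_fun setT (xi i).
  by apply: measurable_funB => //; exact: measurable_funM.
have sup_le (x : nat -> \bar R) (r : R) :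
    (ereal_sup [set average n x | n in [set n | (b <= n)%N]] <= r%:E)%E ->
    forall n, (b <= n)%N -> (average n x <= r%:E)%E.
  by move=> xr n bn; apply: le_trans xr; apply: ereal_sup_ubound; exists n.
have {}Hlower := sup_le _ _ Hlower; have {}Htail := sup_le _ _ Htail.
(* Averages are controlled only from length [b] on, but every index [i], even below [b], enters the
   average of length [b + i]; hence each single moment is finite. *)
have fin_of (x : nat -> \bar R) (r : R) : (forall i, 0 <= x i)%E ->
    (forall n, (b <= n)%N -> (average n x <= r%:E)%E) -> forall i, (x i < +oo)%E.
  move=> x0 xr i; apply: (@average_lt_pinfty _ (b + i) i x) => //.
    by rewrite (le_lt_trans (xr _ _)) ?leq_addr// ltry.
  by rewrite -[ltnLHS]add0n ltn_add2r.
pose l i := lower_tail_moment P c (xi i).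
pose t i := exp_tail_moment P h (xi i).
pose m i := 'E_P[fun w => expR (y * xi i w)]%E.
have l0 i : (0 <= l i)%E by exact: lower_tail_moment_ge0.
have t0 i : (0 <= t i)%E by exact: exp_tail_moment_ge0.
have loo := fin_of _ _ l0 Hlower; have too := fin_of _ _ t0 Htail.
have lfin i : l i \is a fin_num by rewrite ge0_fin_numE// loo.
have tfin i : t i \is a fin_num by rewrite ge0_fin_numE// too.
have efin i : 'E_P[xi i]%E \is a fin_num.
  exact: (@expectation_tails_fin_num _ _ _ P (xi i) c h (mxi i) hc hh (loo i) (too i)).
have mfin i : m i \is a fin_num.
  exact: (@expectation_tilt_fin_num _ _ _ P (xi i) h y (mxi i) hh (ltW y0) yh (too i)).
have m0 i : 0 <= fine (m i).
  by apply: fine_ge0; apply: expectation_ge0 => w; exact: expR_ge0.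
have mt i : fine (m i) <= fine (t i).
  exact: (@expectation_tilt_le_tail _ _ _ P (xi i) h y (mxi i) hh (ltW y0) yh (too i)).
have mtilt i : fine (m i) <= 1 + y * fine 'E_P[xi i]%E + y * fine (l i) +
    y ^+ 2 * M * fine (t i).
  exact: (@expectation_tilt_le _ _ _ P (xi i) c h y (mxi i) hc hh (ltW y0) yh (loo i) (too i)).
pose q := expR (- (y * Delta)).
have q0 : 0 < q by exact: expR_gt0.
have yD : 0 < y * Delta by rewrite mulr_gt0// -oppr_lt0.
have q1 : q < 1 by rewrite expR_lt1 oppr_lt0.
have M0 : 0 <= y ^+ 2 * M.
  by rewrite mulr_ge0 ?sqr_ge0// le_max divr_ge0// sqr_ge0.
have prod_large n : (b <= n)%N -> \prod_(i < n) fine (m i) <= q ^+ n.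
  move=> bn; have n0 : (0 < n)%N := leq_trans hb bn.
  apply: (@prod_le_mean_expr _ n (fun i => fine (m i)) _ n0 m0).
  have He := sum_fine_le_average _ _ _ n0 efin (Hmean _ bn).
  have Hl := sum_fine_le_average _ _ _ n0 lfin (Hlower _ bn).
  have Ht := sum_fine_le_average _ _ _ n0 tfin (Htail _ bn).
  apply: (@le_trans _ _ (n%:R * (1 - y * Delta))); last first.
    by rewrite ler_wpM2l// expR_ge1Dx.
  apply: le_trans; first by apply: ler_sum => i _; exact: mtilt.
  rewrite !big_split/= -!mulr_sumr sumr_const card_ord.
  have := ler_wpM2l (ltW y0) He; have := ler_wpM2l (ltW y0) Hl.
  have := ler_wpM2l M0 Ht.
  (* By definition [- Delta = eps + y * d1 * M - a], so the target is exactly the sum of the three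
     averaged bounds and [n]. *)
  have -> : n%:R * (1 - y * Delta) = n%:R + y * (n%:R * - a) +
      y * (n%:R * eps) + y ^+ 2 * M * (n%:R * d1).
    by rewrite /Delta /Delta_const -/M /y; ring.
  by move=> ht hl he; rewrite !lerD.
have prod_small n : (0 < n)%N -> (n < b)%N -> \prod_(i < n) fine (m i) <= d2 ^+ n.
  move=> n0 nb; apply: (@prod_le_mean_expr _ n (fun i => fine (m i)) _ n0 m0).
  apply: le_trans; first by apply: ler_sum => i _; exact: mt.
  apply: sum_fine_le_average => //; apply: le_trans Htail'.
  by apply: (le_bigmax_seq _ n) => //; rewrite mem_index_iota n0.
have moo i : ('E_P[fun w => expR (y * xi i w)] < +oo)%E.
  by rewrite -ge0_fin_numE ?mfin// expectation_ge0// => w; exact: expR_ge0.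
apply: (le_trans (ruin_probability_le_series P p y u Z theta model y0 u0)).
(* The series is the limit of its partial sums, so a bound uniform in [N] suffices. *)
apply: lime_le.
  apply: is_cvg_nneseries => n _ _; rewrite mule_ge0 ?lee_fin ?expR_ge0//.
  by apply: expectation_ge0 => w; exact: expR_ge0.
apply: nearW => N; rewrite big_mkord.
have -> : (\sum_(n < N) 'E_P[fun w => expR (y * \sum_(k < n.+1) (Z k w - p * theta k w))] *
    (expR (- (y * u)))%:E =
    (\sum_(n < N) (\prod_(i < n.+1) fine (m i)) * expR (- (y * u)))%:E)%E.
  rewrite -sumEFin; apply: eq_bigr => n _; rewrite EFinM; congr (_ * _)%E.
  rewrite (expectation_expR_walk _ _ _ _ _ model (ltW y0) moo) -prodEFin.
  by apply: eq_bigr => i _; rewrite fineK.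
rewrite lee_fin -mulr_suml ler_wpM2r ?expR_ge0//.
have -> : c1_const b h d2 delta Delta = S_const b d2 + q ^+ b / (1 - q).
  by rewrite /c1_const /q -expRM_natl -/y; congr (_ + expR _ / _); ring.
apply: le_trans (sum_expr_le_S_const b N d2 q hb hd2 q0 q1).
(* The summand of index [k] belongs to the walk of length [k.+1], hence the cut at [k.+1 < b]. *)
apply: ler_sum => k _; case: ltnP => [kb|bk]; first exact: prod_small.
exact: prod_large.
Qed.
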